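(* For $\theta_0\in(0,\pi/2)$ let $$\mathsf{SNR}(\theta_0)=\frac{1}{\pi}\left[\Big(\frac{\pi}{2}-\theta_0\Big)\Big(1+\frac{1}{2\sin^2\theta_0}\Big)-\frac{3}{2}\cot\theta_0\right]$$ and $$\mathsf{C}(\theta_0)=-(2\log 2+1)+\frac{4\theta_0}{\pi}\log 2+\frac{2}{\pi}\operatorname{Cl}_2(2\theta_0)+\frac{2\theta_0}{\pi}+\frac{\sin 2\theta_0}{\pi}-\Big(2-\frac{4\theta_0}{\pi}\Big)\log\sin\theta_0 .$$ Setting $\theta_0=\pi/2-\delta$, as $\delta\to0^+$, $$\mathsf{SNR}(\pi/2-\delta)=\frac{2\delta^5}{15\pi}+O(\delta^7),\qquad \mathsf{C}(\pi/2-\delta)=\frac{8\delta^5}{15\pi}+O(\delta^7).$$ Consequently the full-CSIT capacity of the square canonical channel satisfies $\mathsf{C}(\mathsf{SNR})/\mathsf{SNR}\to 4$ (nats) as $\mathsf{SNR}\to0^+$; that is, the low-SNR slope of the capacity equals the upper edge $b=4$ of the limiting spectrum.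
   Context: Logarithms are natural. $\operatorname{Cl}_2(x)=\sum_{n\ge1}\frac{\sin nx}{n^2}$ is the Clausen function. The square ($\beta=1$) Marčenko–Pastur density is $f_1(\lambda)=\frac{1}{2\pi}\sqrt{\frac{4-\lambda}{\lambda}}$ for $\lambda\in(0,4]$; its upper support edge is $b=4$. The (asymptotic, per-receive-antenna) full-CSIT capacity of the square canonical MIMO channel (IID zero-mean complex Gaussian entries, equal numbers of transmit and receive antennas tending to infinity, full channel state information at the transmitter) at signal-to-noise ratio $\mathsf{SNR}>0$ is the waterfilling integral $$\mathsf{C}(\mathsf{SNR})=\int_{\lambda_{\mathrm{cut}}}^{4}\log(\nu\,\mathsf{SNR}\,\lambda)\,f_1(\lambda)\,d\lambda,$$ where the water level $\nu>0$ and the cutoff $\lambda_{\mathrm{cut}}\in(0,4)$ are determined by $$\lambda_{\mathrm{cut}}=\frac{1}{\mathsf{SNR}\,\nu},\qquad \int_{\lambda_{\mathrm{cut}}}^{4}\Big(\nu-\frac{1}{\mathsf{SNR}\,\lambda}\Big)f_1(\lambda)\,d\lambda=1.$$ The angle $\theta_0\in(0,\pi/2)$ parametrizes the cutoff through $\lambda_{\mathrm{cut}}=4\sin^2\theta_0$; $\mathsf{SNR}(\theta_0)$ is the signal-to-noise ratio that produces this cutoff and $\mathsf{C}(\theta_0)$ is the capacity $\mathsf{C}(\mathsf{SNR}(\theta_0))$ at that signal-to-noise ratio. *)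

(* Defs.v *)
From Stdlib Require Import Reals.
From Coquelicot Require Import Coquelicot.
Open Scope R_scope.

(* f = O(g) at 0 from the right, with a constant and a neighbourhood that are
   both unspecified. *)
Definition bigO_right0 (f g : R -> R) : Prop :=
  exists M : R, at_right 0 (fun d => Rabs (f d) <= M * Rabs (g d)).

(* The series starts at n = 1, hence the shift. *)
Definition Cl2 (x : R) : R :=
  Series (fun n : nat => sin (INR (S n) * x) / INR (S n) ^ 2).

(* No case distinction on l is needed: [sqrt] is 0 on negative reals and
   [/ 0 = 0], so this vanishes off the interval (0,4). *)
Definition mpDensity (l : R) : R := / (2 * PI) * sqrt ((4 - l) / l).

Definition waterfilling (snr nu lcut : R) : Prop :=
  0 < nu /\ 0 < lcut < 4 /\ lcut = / (snr * nu) /\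
  is_RInt (fun l => (nu - / (snr * l)) * mpDensity l) lcut 4 1.

(* [iota] is definite description: it returns the level nu whenever exactly
   one exists.  For snr > 0 this is the case, since the constraint reads
   snr = int_lcut^4 (1/lcut - 1/l) mpDensity l dl, whose right-hand side
   decreases strictly and continuously from +oo to 0 as lcut runs through
   (0,4). *)
Definition waterLevel (snr : R) : R :=
  iota (fun nu : R => exists lcut : R, waterfilling snr nu lcut).

Definition cutoff (snr : R) : R := / (snr * waterLevel snr).

Definition capacity (snr : R) : R :=
  RInt (fun l => ln (waterLevel snr * snr * l) * mpDensity l) (cutoff snr) 4.

(* Closed forms of the signal-to-noise ratio and of the capacity in terms of
   the angle t with cutoff 4 * sin t ^ 2, for 0 < t < PI / 2. *)
Definition snrAngle (t : R) : R :=
  / PI * ((PI / 2 - t) * (1 + 1 / (2 * sin t ^ 2))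
          - 3 / 2 * (cos t / sin t)).

Definition capacityAngle (t : R) : R :=
  - (2 * ln 2 + 1) + 4 * t / PI * ln 2 + 2 / PI * Cl2 (2 * t)
  + 2 * t / PI + sin (2 * t) / PI - (2 - 4 * t / PI) * ln (sin t).

(* Main.v *)
Require Import Defs.
From Stdlib Require Import Reals ZArith Factorial Lra Lia Psatz.
From Coquelicot Require Import Coquelicot.
Open Scope R_scope.

(* In terms of [d = PI / 2 - t], [PI * snrAngle] is elementary, and
   [PI * capacityAngle] vanishes at [d = 0] and has derivative
   [4 (d tan d - sin d ^ 2) = 8/3 d ^ 4 + O(d ^ 6)], because the Clausen term
   contributes [4 ln (2 cos d)]. That derivative is justified on the partial
   sums of [Cl2], with the explicit error [O(1/N)] of the Fourier series of
   [ln (2 cos d)].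

   The slope needs no closed form. With cutoff [c], the constraint reads
   [snr = int_c^4 (1/c - 1/l) mpDensity l dl] and the capacity is
   [int_c^4 ln (l/c) mpDensity l dl]; since
   [c (1/c - 1/l) <= ln (l/c) <= 4 (1/c - 1/l)] on [c, 4], the quotient
   [capacity snr / snr] lies between [c] and [4], and [c] tends to [4] as
   [snr] tends to [0]. *)

(** * Expansion of the signal-to-noise ratio *)

Lemma INR_fact_values :
  INR (fact 0) = 1 /\ INR (fact 1) = 1 /\ INR (fact 2) = 2 /\
  INR (fact 3) = 6 /\ INR (fact 4) = 24 /\ INR (fact 5) = 120 /\
  INR (fact 6) = 720 /\ INR (fact 7) = 5040 /\ INR (fact 8) = 40320 /\
  INR (fact 9) = 362880.
Proof.
  (* Moving to [Z] lets the factorials be computed in binary instead of unary. *)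
  repeat split; rewrite INR_IZR_INZ; apply f_equal;
    repeat (rewrite fact_simpl, Nat2Z.inj_mul); reflexivity.
Qed.

Lemma pow_antitone_unit (x : R) (n k : nat) : 0 <= x <= 1 -> x ^ (n + k) <= x ^ n.
Proof.
  intros Hx; rewrite pow_add.
  assert (0 <= x ^ n) by (apply pow_le; lra).
  assert (x ^ k <= 1) by (rewrite <- (pow1 k); apply pow_incr; lra).
  nra.
Qed.

Lemma sin_taylor_bounds (x : R) : 0 <= x <= 1 ->
  x - x ^ 3 / 6 <= sin x <= x /\
  x - x ^ 3 / 6 + x ^ 5 / 120 - x ^ 7 / 5040 <= sin x
    <= x - x ^ 3 / 6 + x ^ 5 / 120.
Proof.
  intros Hx.
  destruct INR_fact_values as (F0 & F1 & F2 & F3 & F4 & F5 & F6 & F7 & F8 & F9).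
  destruct (pre_sin_bound x 0) as [H1 H2]; [lra | lra |].
  destruct (pre_sin_bound x 1) as [H3 H4]; [lra | lra |].
  unfold sin_approx, sin_term in *.
  cbn [sum_f_R0 Nat.mul Nat.add] in *.
  rewrite ?F1, ?F3, ?F5, ?F7, ?F9 in *.
  assert (0 <= x ^ 3) by (apply pow_le; lra).
  assert (0 <= x ^ 5) by (apply pow_le; lra).
  assert (0 <= x ^ 7) by (apply pow_le; lra).
  (* [x ^ 5 <= x ^ 3] turns the upper bound of degree 5 into [sin x <= x]. *)
  pose proof (pow_antitone_unit x 3 2 Hx).
  pose proof (pow_antitone_unit x 7 2 Hx).
  simpl Nat.add in *; repeat split; lra.
Qed.

Lemma cos_taylor_bounds (x : R) : 0 <= x <= 1 ->
  1 - x ^ 2 / 2 <= cos x <= 1 /\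
  1 - x ^ 2 / 2 + x ^ 4 / 24 - x ^ 6 / 720 <= cos x
    <= 1 - x ^ 2 / 2 + x ^ 4 / 24.
Proof.
  intros Hx.
  destruct INR_fact_values as (F0 & F1 & F2 & F3 & F4 & F5 & F6 & F7 & F8 & F9).
  destruct (pre_cos_bound x 0) as [H1 H2]; [lra | lra |].
  destruct (pre_cos_bound x 1) as [H3 H4]; [lra | lra |].
  unfold cos_approx, cos_term in *.
  cbn [sum_f_R0 Nat.mul Nat.add] in *.
  rewrite ?F0, ?F2, ?F4, ?F6, ?F8 in *.
  pose proof (COS_bound x).
  repeat split; lra.
Qed.

Lemma cos_ge_half (x : R) : 0 <= x <= 1 -> 1 / 2 <= cos x.
Proof.
  intros Hx; destruct (cos_taylor_bounds x Hx) as [[H _] _]; nra.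
Qed.

(** Disposes of the denominators [cos u] and [PI * cos d ^ 2]: near 0 they stay above [1 / 2], so
    each costs at most a factor 2. *)
Lemma Rabs_div_le (a b c : R) : 1 / 2 <= c -> Rabs a <= b -> Rabs (a / c) <= 2 * b.
Proof.
  intros Hc Ha.
  assert (0 <= b) by (pose proof (Rabs_pos a); lra).
  unfold Rdiv; rewrite Rabs_mult, (Rabs_pos_eq (/ c))
    by (apply Rlt_le, Rinv_0_lt_compat; lra).
  assert (/ c <= 2)
    by (replace 2 with (/ (1 / 2)) by field; apply Rinv_le_contravar; lra).
  assert (0 < / c) by (apply Rinv_0_lt_compat; lra).
  pose proof (Rabs_pos a).
  nra.
Qed.

Lemma bigO_right0_of_bound (f g : R -> R) (M r : R) :
  0 < r -> (forall d, 0 < d <= r -> Rabs (f d) <= M * Rabs (g d)) ->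
  bigO_right0 f g.
Proof.
  intros Hr H; exists M, (mkposreal r Hr); intros d Hd Hpos.
  apply H; split; [exact Hpos |].
  apply Rabs_lt_between in Hd; simpl in Hd;
    unfold minus, plus, opp in Hd; simpl in Hd; lra.
Qed.

(** Over the denominator [PI * cos d ^ 2], double angles turn the main part of the numerator into
    [d + d cos (2 d) / 2 - 3/4 sin (2 d)]. Its terms in [d] and [d ^ 3] cancel, and [d ^ 5] has
    coefficient [1/3 - 1/5 = 2/15]. *)
Lemma snrAngle_expansion (d : R) : 0 < d <= 1 / 2 ->
  Rabs (snrAngle (PI / 2 - d) - 2 * d ^ 5 / (15 * PI)) <= d ^ 7.
Proof.
  intros Hd.
  pose proof (proj1 (cos_taylor_bounds d ltac:(lra))) as [Hc _].
  assert (7 / 8 <= cos d) by nra.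
  pose proof PI2_1 as Hpi.
  pose proof (sin2_cos2 d) as Hsc; unfold Rsqr in Hsc.
  unfold snrAngle; rewrite sin_shift, cos_shift.
  replace (_ - _) with
    ((d * (1 / 2 + cos d ^ 2) - 3 / 2 * (sin d * cos d)
      - 2 / 15 * d ^ 5 * cos d ^ 2) / (PI * cos d ^ 2)) by (field; lra).
  replace (d ^ 7) with (2 * (d ^ 7 / 2)) by field.
  apply Rabs_div_le; [nra |].
  destruct (cos_taylor_bounds (2 * d) ltac:(lra)) as [_ [C1 C2]].
  destruct (sin_taylor_bounds (2 * d) ltac:(lra)) as [_ [S1 S2]].
  destruct (sin_taylor_bounds d ltac:(lra)) as [[S3 S4] _].
  assert (0 <= sin d) by nra.
  replace (sin d * cos d) with (sin (2 * d) / 2) by (rewrite sin_2a; field).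
  (* The first [cos d ^ 2] has to be expanded precisely. The second is multiplied by [d ^ 5], so
     [1 - sin d ^ 2] with [0 <= sin d ^ 2 <= d ^ 2] is accurate enough. *)
  replace (cos d ^ 2) with ((1 + cos (2 * d)) / 2) at 1
    by (rewrite cos_2a_cos; field).
  replace (cos d ^ 2) with (1 - sin d ^ 2) by (simpl; lra).
  assert (0 <= sin d ^ 2 <= d ^ 2) by (simpl; nra).
  assert (0 < d ^ 5) by (apply pow_lt; lra).
  assert (0 < d ^ 7) by (apply pow_lt; lra).
  assert (0 <= d ^ 5 * sin d ^ 2 <= d ^ 7).
  { replace (d ^ 7) with (d ^ 5 * d ^ 2) by ring. nra. }
  assert (d * (1 - (2 * d) ^ 2 / 2 + (2 * d) ^ 4 / 24 - (2 * d) ^ 6 / 720)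
          <= d * cos (2 * d)) by (apply Rmult_le_compat_l; lra).
  assert (d * cos (2 * d) <= d * (1 - (2 * d) ^ 2 / 2 + (2 * d) ^ 4 / 24))
    by (apply Rmult_le_compat_l; lra).
  apply Rabs_le; split; lra.
Qed.

(** Serves the derivative of the capacity. Apart from the subtracted [u ^ 4] term, the numerator
    over [cos u] is [sin u * w] with [w = u - sin (2 u) / 2 = 2/3 u ^ 3 + O(u ^ 5)]. *)
Lemma tan_sin_expansion (u : R) : 0 <= u <= 1 / 2 ->
  Rabs (u * (sin u / cos u) - sin u ^ 2 - 2 / 3 * u ^ 4) <= 2 * u ^ 6.
Proof.
  intros Hu.
  pose proof (cos_ge_half u ltac:(lra)) as Hc.
  replace (_ - _) with
    ((sin u * (u - sin (2 * u) / 2) - 2 / 3 * u ^ 4 * cos u) / cos u)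
    by (rewrite sin_2a; field; lra).
  apply Rabs_div_le; [lra |].
  destruct (sin_taylor_bounds (2 * u) ltac:(lra)) as [_ [S1 S2]].
  destruct (sin_taylor_bounds u ltac:(lra)) as [[S3 S4] _].
  destruct (cos_taylor_bounds u ltac:(lra)) as [[C1 C2] _].
  assert (0 <= u ^ 3) by (apply pow_le; lra).
  assert (0 <= u ^ 4) by (apply pow_le; lra).
  assert (0 <= u ^ 5) by (apply pow_le; lra).
  assert (0 <= u ^ 6) by (apply pow_le; lra).
  pose proof (pow_antitone_unit u 5 2 ltac:(lra)); simpl Nat.add in *.
  assert (0 <= sin u) by nra.
  assert (u ^ 4 * (1 - u ^ 2 / 2) <= u ^ 4 * cos u <= u ^ 4) by nra.
  set (w := u - sin (2 * u) / 2) in *.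
  assert (W1 : 2 / 3 * u ^ 3 - 2 / 15 * u ^ 5 <= w) by (unfold w; lra).
  assert (W2 : w <= 2 / 3 * u ^ 3) by (unfold w; lra).
  assert (U1 : u * w <= u * (2 / 3 * u ^ 3)) by (apply Rmult_le_compat_l; lra).
  assert (U2 : u * (2 / 3 * u ^ 3 - 2 / 15 * u ^ 5) <= u * w)
    by (apply Rmult_le_compat_l; lra).
  assert (0 <= w) by nra.
  assert (sin u * w <= u * w) by nra.
  assert ((u - u ^ 3 / 6) * w <= sin u * w) by nra.
  assert (u ^ 3 * w <= u ^ 3 * (2 / 3 * u ^ 3)) by nra.
  apply Rabs_le; split; lra.
Qed.
(** * Clausen function and expansion of the capacity *)

(** Both [g + f] and [g - f] are nondecreasing. All error bounds on derivatives below are integrated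
    in this way. *)
Lemma Rabs_diff_le_of_derive (f g f' g' : R -> R) (a b : R) :
  a <= b ->
  (forall x, a <= x <= b -> is_derive f x (f' x)) ->
  (forall x, a <= x <= b -> is_derive g x (g' x)) ->
  (forall x, a <= x <= b -> Rabs (f' x) <= g' x) ->
  Rabs (f b - f a) <= g b - g a.
Proof.
  intros Hab Hf Hg Hle.
  assert (mono : forall h h' : R -> R,
    (forall x, a <= x <= b -> is_derive h x (h' x)) ->
    (forall x, a <= x <= b -> 0 <= h' x) -> h a <= h b).
  { intros h h' Hh Hpos.
    destruct (MVT_gen h a b h') as [c [Hc Heq]];
      rewrite ?Rmin_left, ?Rmax_right in * by exact Hab.
    - intros x Hx; apply Hh; lra.
    - intros x Hx; apply continuity_pt_filterlim.
      apply (ex_derive_continuous h); exists (h' x); apply Hh; lra.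
    - assert (0 <= h' c * (b - a)) by (apply Rmult_le_pos; [apply Hpos; lra | lra]).
      lra. }
  apply Rabs_le; split.
  - enough (g a + f a <= g b + f b) by lra.
    apply (mono (fun x => g x + f x) (fun x => g' x + f' x)).
    + intros x Hx; apply (is_derive_plus g f); auto.
    + intros x Hx; specialize (Hle x Hx); apply Rabs_le_between in Hle; lra.
  - enough (g a - f a <= g b - f b) by lra.
    apply (mono (fun x => g x - f x) (fun x => g' x - f' x)).
    + intros x Hx; apply (is_derive_minus g f); auto.
    + intros x Hx; specialize (Hle x Hx); apply Rabs_le_between in Hle; lra.
Qed.

Lemma INR_S_pos (n : nat) : 0 < INR (S n).
Proof. apply lt_0_INR; lia. Qed.

Lemma is_derive_pow_div (n : nat) (x : R) :
  is_derive (fun y => y ^ S n / INR (S n)) x (x ^ n).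
Proof.
  pose proof (INR_S_pos n) as Hn.
  replace (x ^ n) with (INR (S n) * 1 * x ^ pred (S n) * / INR (S n))
    by (simpl pred; field; lra).
  apply (is_derive_scal_l (fun y => y ^ S n) x _ (/ INR (S n))).
  apply (is_derive_pow (fun y => y)), (is_derive_id x).
Qed.

Lemma sum_n_neg_pow (x : R) (N : nat) : 1 + x <> 0 ->
  sum_n (fun n => (- x) ^ n) N = (1 - (- x) ^ S N) / (1 + x).
Proof.
  intros Hx; induction N as [|N IH].
  - rewrite sum_O; simpl; field; exact Hx.
  - rewrite sum_Sn, IH; unfold plus; simpl; field; exact Hx.
Qed.

(** On [0, 1] the error of the Taylor polynomial of [ln (1 + x)] has derivative
    [- (- x) ^ (N + 1) / (1 + x)], dominated by [x ^ (N + 1)], the derivative of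
    [x ^ (N + 2) / (N + 2)]. *)
Lemma alternating_harmonic_ln2 (N : nat) :
  Rabs (sum_n (fun n => (-1) ^ n / INR (S n)) N - ln 2) <= / INR (S (S N)).
Proof.
  pose (f := fun x => sum_n (fun n => (-1) ^ n * x ^ S n / INR (S n)) N - ln (1 + x)).
  pose (g := fun x : R => x ^ S (S N) / INR (S (S N))).
  assert (H : Rabs (f 1 - f 0) <= g 1 - g 0).
  { apply (Rabs_diff_le_of_derive f g
      (fun x => sum_n (fun n => (- x) ^ n) N - / (1 + x)) (fun x => x ^ S N)).
    - lra.
    - intros x Hx; unfold f.
      apply (is_derive_minus (fun x => sum_n _ N) (fun x => ln (1 + x))).
      + apply (is_derive_sum_n (fun n x => (-1) ^ n * x ^ S n / INR (S n)) N x
                 (fun n => (- x) ^ n)); intros k _.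
        replace ((- x) ^ k) with ((-1) ^ k * x ^ k)
          by (rewrite <- Rpow_mult_distr; f_equal; ring).
        apply (is_derive_ext (fun y => (-1) ^ k * (y ^ S k / INR (S k))));
          [intros y; symmetry; apply Rmult_assoc |].
        apply (is_derive_scal (fun y => y ^ S k / INR (S k))), is_derive_pow_div.
      + auto_derive; [lra | field; lra].
    - intros x Hx; apply is_derive_pow_div.
    - intros x Hx.
      rewrite sum_n_neg_pow by lra.
      replace ((1 - (- x) ^ S N) / (1 + x) - / (1 + x))
        with (- ((- x) ^ S N) / (1 + x)) by (field; lra).
      unfold Rdiv; rewrite Rabs_mult, Rabs_Ropp, <- RPow_abs, Rabs_Ropp.
      rewrite (Rabs_pos_eq x) by lra.
      rewrite (Rabs_pos_eq (/ _)) by (apply Rlt_le, Rinv_0_lt_compat; lra).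
      assert (0 <= x ^ S N) by (apply pow_le; lra).
      assert (/ (1 + x) <= 1) by (rewrite <- Rinv_1; apply Rinv_le_contravar; lra).
      nra. }
  assert (F1 : f 1 = sum_n (fun n => (-1) ^ n / INR (S n)) N - ln 2).
  { unfold f; replace (1 + 1) with 2 by ring; apply (f_equal (fun s => s - ln 2)).
    apply sum_n_ext; intros n; rewrite pow1, Rmult_1_r; reflexivity. }
  assert (F0 : f 0 = 0).
  { unfold f; rewrite Rplus_0_r, ln_1, Rminus_0_r.
    rewrite (sum_n_ext _ (fun _ => 0)).
    - rewrite sum_n_const; ring.
    - intros n; rewrite pow_i, Rmult_0_r by lia; apply Rmult_0_l. }
  assert (G1 : g 1 = / INR (S (S N))) by (unfold g; rewrite pow1; unfold Rdiv; ring).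
  assert (G0 : g 0 = 0) by (unfold g; rewrite pow_i by lia; unfold Rdiv; ring).
  rewrite <- F1, <- G1.
  rewrite F0, G0, !Rminus_0_r in H; exact H.
Qed.

(** A Dirichlet kernel: since [2 sin (2 k u) cos u = sin ((2 k + 1) u) + sin ((2 k - 1) u)], the
    alternating sum telescopes after multiplication by [cos u]. *)
Lemma sum_n_alternating_sin (u : R) (N : nat) : cos u <> 0 ->
  sum_n (fun n => (-1) ^ n * (2 * sin (2 * INR (S n) * u))) N
  = sin u / cos u + (-1) ^ N * sin ((2 * INR N + 3) * u) / cos u.
Proof.
  intros Hu; induction N as [|N IH].
  - rewrite sum_O; simpl.
    replace ((2 * 0 + 3) * u) with (2 * u + u) by ring.
    replace (2 * 1 * u) with (2 * u) by ring.
    rewrite sin_plus, sin_2a, cos_2a_cos; field; exact Hu.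
  - rewrite sum_Sn, IH, !S_INR; change (@plus R_AbelianMonoid) with Rplus; cbn [pow].
    set (a := (2 * INR N + 4) * u).
    replace (2 * (INR N + 1 + 1) * u) with a by (unfold a; ring).
    replace ((2 * (INR N + 1) + 3) * u) with (a + u) by (unfold a; ring).
    replace ((2 * INR N + 3) * u) with (a - u) by (unfold a; ring).
    rewrite sin_plus, sin_minus.
    apply Rminus_diag_uniq; field; exact Hu.
Qed.

(* The derivative of the error is [-(-1)^N sin (m u) / cos u] with
   [m = 2 N + 3]; adding [(-1)^(N+1) cos (m u) / (m cos u)], as in an
   integration by parts, makes it [O(1/m)]. *)
Lemma fourier_ln_cos_error (N : nat) (u : R) : 0 <= u <= 1 ->
  Rabs (sum_n (fun n => (-1) ^ n * (cos (2 * INR (S n) * u) / INR (S n))) N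
        - ln (2 * cos u)) <= 8 / INR (S N).
Proof.
  intros Hu.
  pose (D := fun v =>
    sum_n (fun n => (-1) ^ n * (cos (2 * INR (S n) * v) / INR (S n))) N
    - ln (2 * cos v)).
  pose (m := 2 * INR N + 3).
  pose (E := fun v => (-1) ^ N * (cos (m * v) / (m * cos v))).
  assert (Hm : 3 <= m) by (unfold m; pose proof (pos_INR N); lra).
  assert (Hsign : Rabs ((-1) ^ N) = 1) by apply pow_1_abs.
  assert (Hcos : forall v, 0 <= v <= 1 -> 1 / 2 <= cos v) by exact cos_ge_half.
  assert (Hneg : forall x, -1 * x = - x) by (intros x; ring).
  assert (Hinvm : 0 < / m) by (apply Rinv_0_lt_compat; lra).
  assert (HK : Rabs ((D u - E u) - (D 0 - E 0)) <= 4 / m * u - 4 / m * 0).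
  { apply (Rabs_diff_le_of_derive (fun v => D v - E v) (fun v => 4 / m * v)
      (fun v => - ((-1) ^ N * (cos (m * v) * sin v / (m * cos v ^ 2))))
      (fun v => 4 / m)).
    - lra.
    - intros v Hv; specialize (Hcos v ltac:(lra)).
      replace (- ((-1) ^ N * (cos (m * v) * sin v / (m * cos v ^ 2)))) with
        ((- (sin v / cos v + (-1) ^ N * sin (m * v) / cos v) - - (sin v / cos v))
         - (-1) ^ N * (- sin (m * v) / cos v + cos (m * v) * sin v / (m * cos v ^ 2)))
        by (field; lra).
      apply (is_derive_minus D E).
      + apply (is_derive_minus (fun v => sum_n _ N) (fun v => ln (2 * cos v))).
        * unfold m; rewrite <- sum_n_alternating_sin by lra.
          replace (- sum_n _ N) with
            (sum_n (fun n => -1 * ((-1) ^ n * (2 * sin (2 * INR (S n) * v)))) N);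
            [| exact (eq_trans (sum_n_mult_l (K := R_Ring) (-1) _ N)
                        (Hneg _))].
          apply (is_derive_sum_n
            (fun n v => (-1) ^ n * (cos (2 * INR (S n) * v) / INR (S n))) N v
            (fun n => -1 * ((-1) ^ n * (2 * sin (2 * INR (S n) * v))))).
          intros k _; pose proof (INR_S_pos k); set (c := INR (S k)) in *.
          auto_derive; [trivial | field; lra].
        * auto_derive; [lra | field; lra].
      + unfold E; auto_derive; [nra | field; lra].
    - intros v Hv; auto_derive; [trivial | ring].
    - intros v Hv; specialize (Hcos v ltac:(lra)).
      rewrite Rabs_Ropp, Rabs_mult, Hsign, Rmult_1_l.
      replace (cos (m * v) * sin v / (m * cos v ^ 2))
        with (cos (m * v) * sin v / m / cos v / cos v) by (field; lra).
      (* Each of the two factors [1 / cos v] costs 2, whence the constant 4. *)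
      replace (4 / m) with (2 * (2 * / m)) by (field; lra).
      do 2 (apply Rabs_div_le; [exact Hcos |]).
      unfold Rdiv; rewrite !Rabs_mult, (Rabs_pos_eq (/ m)) by lra.
      assert (Rabs (cos (m * v)) <= 1) by (apply Rabs_le, COS_bound).
      assert (Rabs (sin v) <= 1) by (apply Rabs_le, SIN_bound).
      pose proof (Rabs_pos (cos (m * v))); pose proof (Rabs_pos (sin v)).
      assert (Rabs (cos (m * v)) * Rabs (sin v) <= 1) by nra.
      nra. }
  assert (HE : forall v, 0 <= v <= 1 -> Rabs (E v) <= 2 * / m).
  { intros v Hv; unfold E.
    rewrite Rabs_mult, Hsign, Rmult_1_l.
    specialize (Hcos v Hv).
    replace (cos (m * v) / (m * cos v)) with (cos (m * v) / m / cos v)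
      by (field; lra).
    apply Rabs_div_le; [exact Hcos |].
    unfold Rdiv; rewrite !Rabs_mult, (Rabs_pos_eq (/ m)) by lra.
    assert (Rabs (cos (m * v)) <= 1) by (apply Rabs_le, COS_bound).
    nra. }
  (* At 0 the cosines are 1 and [ln (2 cos 0) = ln 2], so the error is that of the alternating
     harmonic series. *)
  assert (HD0 : Rabs (D 0) <= / INR (S (S N))).
  { pose proof (alternating_harmonic_ln2 N) as H.
    unfold D; rewrite cos_0, Rmult_1_r.
    erewrite sum_n_ext; [exact H |].
    intros n; cbv beta; rewrite Rmult_0_r, cos_0; unfold Rdiv.
    apply f_equal, Rmult_1_l. }
  assert (Rabs (D u) <= Rabs (D u - E u - (D 0 - E 0)) + Rabs (D 0)
            + Rabs (E 0) + Rabs (E u)).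
  { replace (D u) with ((D u - E u - (D 0 - E 0)) + D 0 + - E 0 + E u) at 1 by ring.
    rewrite <- (Rabs_Ropp (E 0)).
    repeat (eapply Rle_trans; [apply Rabs_triang |]; apply Rplus_le_compat_r).
    apply Rle_refl. }
  pose proof (HE 0 ltac:(lra)); pose proof (HE u Hu).
  pose proof (INR_S_pos N) as HN.
  (* The four contributions add up to at most [8 / m + 1 / (N + 2)], which is at most
     [5 / (N + 1)]. *)
  assert (/ m <= / 2 * / INR (S N)).
  { rewrite <- Rinv_mult; apply Rinv_le_contravar; [lra |].
    rewrite S_INR; unfold m; lra. }
  assert (/ INR (S (S N)) <= / INR (S N)).
  { apply Rinv_le_contravar; [lra | rewrite (S_INR (S N)); lra]. }
  assert (4 / m * u <= 4 * / m) by (unfold Rdiv; nra).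
  fold (D u).
  unfold Rdiv; lra.
Qed.

Lemma sin_INR_PI_minus (k : nat) (y : R) :
  sin (INR k * PI - y) = - (-1) ^ k * sin y.
Proof.
  induction k as [|k IH].
  - simpl; rewrite Rmult_0_l, Rminus_0_l, sin_neg; ring.
  - replace (INR (S k) * PI - y) with (INR k * PI - y + PI)
      by (rewrite S_INR; ring).
    rewrite neg_sin, IH; simpl; ring.
Qed.

(** For [c >= 1], [1 / c ^ 2 <= 2 / (c (c + 1))]. This majorant telescopes, which gives convergence
    in [ex_series_Cl2]. *)
Lemma Cl2_term_bound (x : R) (n : nat) :
  Rabs (sin (INR (S n) * x) / INR (S n) ^ 2)
    <= 2 * (/ INR (S n) - / INR (S (S n))).
Proof.
  pose proof (INR_S_pos n) as Hn.
  assert (1 <= INR (S n)) by (rewrite S_INR; pose proof (pos_INR n); lra).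
  rewrite (S_INR (S n)); set (c := INR (S n)) in *.
  assert (0 < / c ^ 2) by (apply Rinv_0_lt_compat, pow_lt; lra).
  unfold Rdiv; rewrite Rabs_mult, (Rabs_pos_eq (/ c ^ 2)) by lra.
  assert (Rabs (sin (c * x)) <= 1) by (apply Rabs_le, SIN_bound).
  apply Rle_trans with (/ c ^ 2); [nra |].
  replace (/ c ^ 2) with (2 * (/ (2 * c * c))) by (field; lra).
  replace (/ c - / (c + 1)) with (/ (c * (c + 1))) by (field; lra).
  apply Rmult_le_compat_l; [lra |].
  apply Rinv_le_contravar; nra.
Qed.

Lemma ex_series_Cl2 (x : R) :
  ex_series (fun n => sin (INR (S n) * x) / INR (S n) ^ 2).
Proof.
  apply (ex_series_le (V := R_CompleteNormedModule) _
           (fun n => 2 * (/ INR (S n) - / INR (S (S n)))));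
    [exact (Cl2_term_bound x) |].
  (* The partial sums of the majorant are [2 (1 - 1 / (N + 2))]. *)
  exists 2.
  assert (Hs : forall N, sum_n (fun n => 2 * (/ INR (S n) - / INR (S (S n)))) N
                         = 2 * (1 - / INR (S (S N)))).
  { induction N as [|N IH].
    - rewrite sum_O; simpl; field.
    - rewrite sum_Sn, IH; change (@plus R_AbelianMonoid) with Rplus;
        apply Rminus_diag_uniq; ring. }
  change (is_lim_seq (sum_n (fun n => 2 * (/ INR (S n) - / INR (S (S n))))) 2).
  apply (is_lim_seq_ext (fun N => 2 * (1 - / INR (S (S N)))));
    [intros N; symmetry; apply Hs |].
  replace (Finite 2) with (Rbar_mult 2 (1 - 0)) by (simpl; f_equal; ring).
  apply is_lim_seq_scal_l, is_lim_seq_minus'; [apply is_lim_seq_const |].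
  apply (is_lim_seq_inv _ p_infty); [| discriminate].
  apply -> (is_lim_seq_incr_1 (fun n => INR (S n))).
  apply -> (is_lim_seq_incr_1 INR); apply is_lim_seq_INR.
Qed.

(** At the angle [PI - 2 d] the k-th sine is [(-1) ^ (k - 1) sin (2 k d)]. Convergence is supplied
    separately because [Series] is total and equals the limit of the partial sums only if they
    converge. *)
Lemma is_lim_seq_Cl2_reflected (d : R) :
  is_lim_seq
    (sum_n (fun n => (-1) ^ n * (sin (2 * INR (S n) * d) / INR (S n) ^ 2)))
    (Cl2 (2 * (PI / 2 - d))).
Proof.
  apply (is_lim_seq_ext (sum_n (fun n =>
    sin (INR (S n) * (2 * (PI / 2 - d))) / INR (S n) ^ 2))).
  - intros N; apply sum_n_ext; intros n; cbv beta.
    replace (INR (S n) * (2 * (PI / 2 - d)))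
      with (INR (S n) * PI - 2 * INR (S n) * d) by field.
    rewrite sin_INR_PI_minus; change ((-1) ^ S n) with (-1 * (-1) ^ n).
    unfold Rdiv; apply Rminus_diag_uniq; ring.
  - apply Series_correct, ex_series_Cl2.
Qed.

(* The [N]-th truncation of [PI * capacityAngle (PI / 2 - d)], whose derivative
   is elementary up to the error of the Fourier series of [ln (2 cos d)]. *)
Definition capacityTrunc (N : nat) (d : R) : R :=
  2 * sum_n (fun n => (-1) ^ n * (sin (2 * INR (S n) * d) / INR (S n) ^ 2)) N
  - 4 * d * ln 2 - 2 * d + sin (2 * d) - 4 * d * ln (cos d).

(** The derivative of the left-hand difference is 4 times the Fourier error plus 4 times the error
    in [tan_sin_expansion], hence at most [32 / (N + 1) + 8 v ^ 6]. Everything vanishes at 0, so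
    this integrates to the bound. *)
Lemma capacityTrunc_expansion (N : nat) (d : R) : 0 <= d <= 1 / 2 ->
  Rabs (capacityTrunc N d - 8 / 15 * d ^ 5)
    <= 32 / INR (S N) * d + 8 / 7 * d ^ 7.
Proof.
  intros Hd; pose proof (INR_S_pos N) as HN.
  assert (H : Rabs ((capacityTrunc N d - 8 / 15 * d ^ 5)
                    - (capacityTrunc N 0 - 8 / 15 * 0 ^ 5))
              <= (32 / INR (S N) * d + 8 / 7 * d ^ 7)
                 - (32 / INR (S N) * 0 + 8 / 7 * 0 ^ 7)).
  { apply (Rabs_diff_le_of_derive
      (fun v => capacityTrunc N v - 8 / 15 * v ^ 5)
      (fun v => 32 / INR (S N) * v + 8 / 7 * v ^ 7)
      (fun v =>
        4 * (sum_n (fun n => (-1) ^ n * (cos (2 * INR (S n) * v) / INR (S n))) N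
             - ln (2 * cos v))
        + 4 * (v * (sin v / cos v) - sin v ^ 2 - 2 / 3 * v ^ 4))
      (fun v => 32 / INR (S N) + 8 * v ^ 6)).
    - lra.
    - intros v Hv.
      pose proof (cos_ge_half v ltac:(lra)) as Hc.
      set (t := fun n => (-1) ^ n * (cos (2 * INR (S n) * v) / INR (S n))).
      rewrite ln_mult by lra.
      (* Rewrites the derivative in the form that termwise differentiation yields;
         [2 cos (2 v) - 2 = - 4 sin v ^ 2] accounts for the squared sine. *)
      replace (4 * (sum_n t N - (ln 2 + ln (cos v)))
        + 4 * (v * (sin v / cos v) - sin v ^ 2 - 2 / 3 * v ^ 4)) with
        (4 * sum_n t N + (- 4 * ln 2 - 2 + 2 * cos (2 * v) - 4 * ln (cos v)
          + 4 * v * (sin v / cos v) - 8 / 3 * v ^ 4))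
        by (rewrite cos_2a_sin; generalize (sum_n t N); intros s; field; lra).
      apply (is_derive_ext (fun v =>
        2 * sum_n (fun n => (-1) ^ n * (sin (2 * INR (S n) * v) / INR (S n) ^ 2)) N
        + (- 4 * v * ln 2 - 2 * v + sin (2 * v) - 4 * v * ln (cos v)
           - 8 / 15 * v ^ 5))).
      { intros y; unfold capacityTrunc; apply Rminus_diag_uniq; ring. }
      apply (is_derive_plus (fun v => 2 * sum_n _ N)).
      + replace (4 * sum_n t N) with (2 * (2 * sum_n t N)) by ring.
        apply (is_derive_scal (fun v => sum_n _ N)).
        replace (2 * sum_n t N) with (sum_n (fun n => 2 * t n) N)
          by exact (sum_n_mult_l (K := R_Ring) 2 t N).
        apply (is_derive_sum_n (fun n v =>
          (-1) ^ n * (sin (2 * INR (S n) * v) / INR (S n) ^ 2)) N v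
          (fun n => 2 * t n)).
        intros k _; pose proof (INR_S_pos k); unfold t; set (c := INR (S k)) in *.
        auto_derive; [trivial | field; lra].
      + auto_derive; [lra | field; lra].
    - intros v Hv; set (c := INR (S N)) in *; auto_derive; [trivial | field; lra].
    - intros v Hv.
      eapply Rle_trans; [apply Rabs_triang |].
      rewrite !Rabs_mult, (Rabs_pos_eq 4) by lra.
      pose proof (fourier_ln_cos_error N v ltac:(lra)).
      pose proof (tan_sin_expansion v ltac:(lra)).
      unfold Rdiv in *; lra. }
  assert (H0 : capacityTrunc N 0 = 0).
  { unfold capacityTrunc.
    rewrite (sum_n_ext _ (fun _ => 0)).
    - rewrite sum_n_const, !Rmult_0_r, sin_0; ring.
    - intros n; rewrite Rmult_0_r, sin_0; unfold Rdiv; rewrite Rmult_0_l.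
      apply Rmult_0_r. }
  rewrite H0 in H.
  replace (capacityTrunc N d - 8 / 15 * d ^ 5) with
    (capacityTrunc N d - 8 / 15 * d ^ 5 - (0 - 8 / 15 * 0 ^ 5)) by ring.
  eapply Rle_trans; [exact H | right; ring].
Qed.

(** With [d] fixed, the bound on the truncations passes to the limit in [N]: the term
    [32 d / (N + 1)] disappears, and division by [PI > 2] brings [8 / 7] below 1. *)
Lemma capacityAngle_expansion (d : R) : 0 < d <= 1 / 2 ->
  Rabs (capacityAngle (PI / 2 - d) - 8 * d ^ 5 / (15 * PI)) <= d ^ 7.
Proof.
  intros Hd.
  pose proof PI2_1 as Hpi.
  assert (Hlim : is_lim_seq (fun N => capacityTrunc N d)
    (PI * capacityAngle (PI / 2 - d))).
  { unfold capacityTrunc.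
    apply (is_lim_seq_ext (fun N =>
      2 * sum_n (fun n => (-1) ^ n * (sin (2 * INR (S n) * d) / INR (S n) ^ 2)) N
      + (- 4 * d * ln 2 - 2 * d + sin (2 * d) - 4 * d * ln (cos d)))).
    { intros N; ring. }
    replace (PI * capacityAngle (PI / 2 - d)) with
      (2 * Cl2 (2 * (PI / 2 - d))
       + (- 4 * d * ln 2 - 2 * d + sin (2 * d) - 4 * d * ln (cos d))).
    - apply is_lim_seq_plus'; [| apply is_lim_seq_const].
      apply (is_lim_seq_scal_l _ 2 (Finite (Cl2 (2 * (PI / 2 - d))))).
      apply is_lim_seq_Cl2_reflected.
    - unfold capacityAngle; rewrite sin_shift.
      replace (sin (2 * (PI / 2 - d))) with (sin (2 * d)).
      + field; lra.
      + rewrite <- sin_PI_x; f_equal; field. }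
  assert (H : Rbar_le (Rabs (PI * capacityAngle (PI / 2 - d) - 8 / 15 * d ^ 5))
                      (0 * d + 8 / 7 * d ^ 7)).
  { apply (is_lim_seq_le
      (fun N => Rabs (capacityTrunc N d - 8 / 15 * d ^ 5))
      (fun N => 32 / INR (S N) * d + 8 / 7 * d ^ 7)).
    - intros N; apply capacityTrunc_expansion; lra.
    - apply (is_lim_seq_abs _ (Finite (_ - _))).
      apply is_lim_seq_minus'; [exact Hlim | apply is_lim_seq_const].
    - apply is_lim_seq_plus'; [| apply is_lim_seq_const].
      apply is_lim_seq_mult'; [| apply is_lim_seq_const].
      replace (Finite 0) with (Rbar_mult 32 0) by (simpl; f_equal; ring).
      apply is_lim_seq_scal_l.
      apply (is_lim_seq_inv _ p_infty); [| discriminate].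
      apply -> (is_lim_seq_incr_1 INR); apply is_lim_seq_INR. }
  cbn [Rbar_le] in H.
  replace (_ - _) with ((PI * capacityAngle (PI / 2 - d) - 8 / 15 * d ^ 5) / PI)
    by (field; lra).
  set (x := PI * capacityAngle (PI / 2 - d) - 8 / 15 * d ^ 5) in *.
  unfold Rdiv; rewrite Rabs_mult, (Rabs_pos_eq (/ PI))
    by (apply Rlt_le, Rinv_0_lt_compat; lra).
  assert (0 < d ^ 7) by (apply pow_lt; lra).
  assert (/ PI <= / 2) by (apply Rinv_le_contravar; lra).
  assert (0 < / PI) by (apply Rinv_0_lt_compat; lra).
  pose proof (Rabs_pos x).
  nra.
Qed.
(** * Water level and low-SNR slope *)

Lemma mpDensity_pos (l : R) : 0 < l < 4 -> 0 < mpDensity l.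
Proof.
  intros Hl; pose proof PI_RGT_0.
  apply Rmult_lt_0_compat; [apply Rinv_0_lt_compat; lra |].
  apply sqrt_lt_R0, Rdiv_lt_0_compat; lra.
Qed.

Lemma mpDensity_ge0 (l : R) : 0 <= mpDensity l.
Proof.
  pose proof PI_RGT_0.
  apply Rmult_le_pos; [| apply sqrt_pos].
  apply Rlt_le, Rinv_0_lt_compat; lra.
Qed.

Lemma mpDensity_eq0 (l : R) : 4 <= l -> mpDensity l = 0.
Proof.
  intros Hl; unfold mpDensity; rewrite sqrt_neg_0; [ring |].
  assert (0 < / l) by (apply Rinv_0_lt_compat; lra).
  unfold Rdiv; nra.
Qed.

Lemma mpDensity_is_lub : is_lub (fun l => mpDensity l <> 0) 4.
Proof.
  split.
  - intros l Hl; apply Rnot_lt_le; intros H.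
    apply Hl, mpDensity_eq0; lra.
  - intros b Hb; apply Rnot_lt_le; intros H.
    (* The sample point 3 forces [b >= 3], so that the midpoint of [b] and 4 lies in (0, 4), where
       the density is positive. *)
    assert (H3 : 3 <= b).
    { apply Hb, Rgt_not_eq, mpDensity_pos; lra. }
    assert ((b + 4) / 2 <= b); [| lra].
    apply Hb, Rgt_not_eq, mpDensity_pos; lra.
Qed.

(** True at the edge 4 and beyond as well, since [sqrt], extended by 0, is continuous on all of R.
    The endpoint 4 of the integrals is therefore an ordinary point. *)
Lemma continuous_mpDensity (l : R) : 0 < l -> continuous mpDensity l.
Proof.
  intros Hl; unfold mpDensity.
  apply (continuous_mult (fun _ => / (2 * PI)) (fun l => sqrt ((4 - l) / l)));
    [apply continuous_const |].
  apply (continuous_comp (fun l => (4 - l) / l) sqrt); [| apply continuous_sqrt].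
  apply (ex_derive_continuous (fun l => (4 - l) / l)); auto_derive; lra.
Qed.

Lemma continuous_weighted (g : R -> R) (l : R) :
  0 < l -> ex_derive g l -> continuous (fun y => g y * mpDensity y) l.
Proof.
  intros Hl Hg; apply (continuous_mult g mpDensity).
  - apply (ex_derive_continuous g), Hg.
  - apply continuous_mpDensity, Hl.
Qed.

Lemma ex_RInt_weighted (g : R -> R) (a b : R) : 0 < a -> 0 < b ->
  (forall l, 0 < l -> ex_derive g l) ->
  ex_RInt (fun l => g l * mpDensity l) a b.
Proof.
  intros Ha Hb Hg; apply (ex_RInt_continuous (V := R_CompleteNormedModule)).
  intros l [Hl _]; assert (0 < l) by (pose proof (Rmin_glb_lt _ _ _ Ha Hb); lra).
  apply continuous_weighted; auto.
Qed.

Definition snrOfCutoff (c : R) : R :=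
  RInt (fun l => (/ c - / l) * mpDensity l) c 4.

Lemma ex_derive_inv_sub (c l : R) : 0 < l -> ex_derive (fun l => / c - / l) l.
Proof. intros Hl; auto_derive; lra. Qed.

Lemma inv_sub_pos (c l : R) : 0 < c < l -> 0 < / c - / l.
Proof.
  intros H; assert (/ l < / c); [| lra].
  apply Rinv_lt_contravar; nra.
Qed.

(** Raising the cutoff drops the positive integral over [c, c'], which gives strictness, and lowers
    the integrand on the rest. *)
Lemma snrOfCutoff_decreasing (c c' : R) :
  0 < c -> c < c' -> c' < 4 -> snrOfCutoff c' < snrOfCutoff c.
Proof.
  intros Hc Hcc Hc'; unfold snrOfCutoff.
  rewrite <- (RInt_Chasles (V := R_CompleteNormedModule)
    (fun l => (/ c - / l) * mpDensity l) c c' 4)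
    by (apply ex_RInt_weighted; try lra; apply ex_derive_inv_sub).
  change (@plus _) with Rplus.
  assert (0 < RInt (fun l => (/ c - / l) * mpDensity l) c c').
  { apply RInt_gt_0; [exact Hcc | |].
    - intros l Hl; apply Rmult_lt_0_compat; [apply inv_sub_pos | apply mpDensity_pos]; lra.
    - intros l Hl; apply continuous_weighted; [lra | apply ex_derive_inv_sub; lra]. }
  assert (RInt (fun l => (/ c' - / l) * mpDensity l) c' 4
          <= RInt (fun l => (/ c - / l) * mpDensity l) c' 4).
  { apply RInt_le; try lra;
      try (apply ex_RInt_weighted; try lra; apply ex_derive_inv_sub).
    intros l Hl; apply Rmult_le_compat_r; [apply mpDensity_ge0 |].
    pose proof (inv_sub_pos c c' ltac:(lra)); lra. }
  lra.
Qed.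

Lemma snrOfCutoff_pos (c : R) : 0 < c < 4 -> 0 < snrOfCutoff c.
Proof.
  intros Hc; apply RInt_gt_0; [lra | |].
  - intros l Hl; apply Rmult_lt_0_compat; [apply inv_sub_pos | apply mpDensity_pos]; lra.
  - intros l Hl; apply continuous_weighted; [lra | apply ex_derive_inv_sub; lra].
Qed.

Lemma snrOfCutoff_inj (c c' : R) : 0 < c < 4 -> 0 < c' < 4 ->
  snrOfCutoff c = snrOfCutoff c' -> c = c'.
Proof.
  intros Hc Hc' Heq; destruct (Rtotal_order c c') as [H | [H | H]];
    [| exact H |].
  - pose proof (snrOfCutoff_decreasing c c' ltac:(lra) H ltac:(lra)); lra.
  - pose proof (snrOfCutoff_decreasing c' c ltac:(lra) H ltac:(lra)); lra.
Qed.

Lemma continuous_RInt_weighted (g : R -> R) (c : R) : 0 < c ->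
  (forall l, 0 < l -> ex_derive g l) ->
  continuous (fun c => RInt (fun l => g l * mpDensity l) c 4) c.
Proof.
  intros Hc Hg.
  apply (ex_derive_continuous (fun c => RInt (fun l => g l * mpDensity l) c 4)).
  eexists; apply (is_derive_RInt' (fun l => g l * mpDensity l) _ c 4).
  - exists (mkposreal c Hc); intros y Hy.
    apply (RInt_correct (V := R_CompleteNormedModule)), ex_RInt_weighted; try lra; auto.
    apply Rabs_lt_between in Hy; simpl in Hy;
      unfold minus, plus, opp in Hy; simpl in Hy; lra.
  - apply continuous_weighted; auto.
Qed.

(** The cutoff occurs in the integrand and as a limit of integration. Pulling out the factor [/ c]
    leaves two integrals that depend on it only through the limit. *)
Lemma continuous_snrOfCutoff (c : R) : 0 < c -> continuous snrOfCutoff c.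
Proof.
  intros Hc.
  apply (continuous_ext_loc _ (fun c => / c * RInt (fun l => 1 * mpDensity l) c 4
                        - RInt (fun l => / l * mpDensity l) c 4)).
  - exists (mkposreal c Hc); intros y Hy.
    assert (0 < y).
    { apply Rabs_lt_between in Hy; simpl in Hy;
        unfold minus, plus, opp in Hy; simpl in Hy; lra. }
    assert (H1 : ex_RInt (fun l => 1 * mpDensity l) y 4).
    { apply ex_RInt_weighted; try lra; intros l Hl; auto_derive; trivial. }
    assert (H2 : ex_RInt (fun l => / l * mpDensity l) y 4).
    { apply ex_RInt_weighted; try lra; intros l Hl; auto_derive; lra. }
    symmetry; apply (is_RInt_unique (V := R_CompleteNormedModule)).
    apply (is_RInt_ext (fun l =>
      minus (scal (/ y) (1 * mpDensity l)) (/ l * mpDensity l))).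
    { intros l _; unfold minus, plus, opp, scal; simpl; unfold mult; simpl; ring. }
    apply (is_RInt_minus (fun l => scal (/ y) (1 * mpDensity l))
                         (fun l => / l * mpDensity l)).
    + apply (is_RInt_scal (fun l => 1 * mpDensity l)).
      apply (RInt_correct (V := R_CompleteNormedModule)), H1.
    + apply (RInt_correct (V := R_CompleteNormedModule)), H2.
  - apply (continuous_minus
      (fun c => / c * RInt (fun l => 1 * mpDensity l) c 4)
      (fun c => RInt (fun l => / l * mpDensity l) c 4)).
    + apply (continuous_mult Rinv (fun c => RInt (fun l => 1 * mpDensity l) c 4)).
      * apply (ex_derive_continuous Rinv); auto_derive; lra.
      * apply (continuous_RInt_weighted (fun _ => 1)); [exact Hc |].
        intros l Hl; auto_derive; trivial.
    + apply (continuous_RInt_weighted Rinv); [exact Hc |].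
      intros l Hl; auto_derive; lra.
Qed.

(** Intermediate values between [c0] and 4, where the integral over a single point is 0. The
    location of [c] above [c0] is what drives the slope to 4. *)
Lemma snrOfCutoff_surj (c0 s : R) : 0 < c0 < 4 -> 0 < s < snrOfCutoff c0 ->
  exists c, c0 < c < 4 /\ snrOfCutoff c = s.
Proof.
  intros Hc0 Hs.
  assert (Hcont : forall c, 0 < c -> continuity_pt snrOfCutoff c).
  { intros c Hc; apply continuity_pt_filterlim, continuous_snrOfCutoff, Hc. }
  destruct (IVT_Rbar_decr snrOfCutoff c0 4 (snrOfCutoff c0) (snrOfCutoff 4) s)
    as [c [H1 [H2 H3]]].
  - apply is_lim_continuity, Hcont; lra.
  - apply is_lim_continuity, Hcont; lra.
  - intros c H1 H2; apply Hcont; simpl in H1; lra.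
  - simpl; lra.
  - assert (H4 : snrOfCutoff 4 = 0) by exact (RInt_point 4 _).
    simpl; rewrite H4; lra.
  - exists c; simpl in H1, H2; auto.
Qed.

(** With [nu = / (s * c)] the integrand of the power constraint is [/ s] times that of
    [snrOfCutoff], so the constraint says [snrOfCutoff c / s = 1]. *)
Lemma waterfilling_iff (s nu c : R) : 0 < s -> 0 < c < 4 ->
  waterfilling s nu c <-> nu = / (s * c) /\ snrOfCutoff c = s.
Proof.
  intros Hs Hc.
  assert (Hint : ex_RInt (fun l => (/ c - / l) * mpDensity l) c 4).
  { apply ex_RInt_weighted; try lra; apply ex_derive_inv_sub. }
  assert (Hscal : nu = / (s * c) ->
    is_RInt (fun l => (nu - / (s * l)) * mpDensity l) c 4 (/ s * snrOfCutoff c)).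
  { intros ->.
    apply (is_RInt_ext (fun l => scal (/ s) ((/ c - / l) * mpDensity l))).
    { intros l _; unfold scal; simpl; unfold mult; simpl; rewrite !Rinv_mult; ring. }
    apply (is_RInt_scal (fun l => (/ c - / l) * mpDensity l)).
    apply (RInt_correct (V := R_CompleteNormedModule)), Hint. }
  split.
  - intros (Hnu & _ & Hcut & H1).
    assert (Hnu' : nu = / (s * c)) by (rewrite Hcut; field; lra).
    split; [exact Hnu' |].
    specialize (Hscal Hnu').
    apply (is_RInt_unique (V := R_CompleteNormedModule)) in H1, Hscal.
    rewrite H1 in Hscal.
    apply (Rmult_eq_reg_l (/ s)); [| apply Rinv_neq_0_compat; lra].
    rewrite <- Hscal; field; lra.
  - intros [Hnu Hsnr]; specialize (Hscal Hnu); rewrite Hsnr in Hscal.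
    repeat split; try lra.
    + rewrite Hnu; apply Rinv_0_lt_compat; nra.
    + rewrite Hnu; field; lra.
    + rewrite Rinv_l in Hscal by lra; exact Hscal.
Qed.

(** [iota] can be evaluated only with uniqueness of the level, which injectivity of [snrOfCutoff]
    provides. *)
Lemma waterLevel_snrOfCutoff (c : R) : 0 < c < 4 ->
  waterLevel (snrOfCutoff c) = / (snrOfCutoff c * c).
Proof.
  intros Hc; pose proof (snrOfCutoff_pos c Hc) as Hs.
  apply (iota_unique (V := R_CompleteNormedModule)).
  - intros nu [c' Hw].
    pose proof Hw as (_ & Hc' & _).
    apply waterfilling_iff in Hw as [-> Heq]; [| exact Hs | exact Hc'].
    rewrite (snrOfCutoff_inj c' c Hc' Hc Heq); reflexivity.
  - exists c; apply waterfilling_iff; auto.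
Qed.

(* Integrate [1 - 1/x <= ln x <= x - 1] at [x = l / c]. *)
Lemma capacity_bounds (c : R) : 0 < c < 4 ->
  c * snrOfCutoff c <= capacity (snrOfCutoff c) <= 4 * snrOfCutoff c.
Proof.
  intros Hc; pose proof (snrOfCutoff_pos c Hc) as Hs.
  unfold capacity, cutoff; rewrite (waterLevel_snrOfCutoff c Hc).
  set (s := snrOfCutoff c) in *.
  replace (/ (s * / (s * c))) with c by (field; lra).
  assert (Hscal : forall k, RInt (fun l => k * (/ c - / l) * mpDensity l) c 4 = k * s).
  { intros k; unfold s, snrOfCutoff.
    rewrite <- (RInt_scal (V := R_CompleteNormedModule)).
    - apply RInt_ext; intros l _; apply Rmult_assoc.
    - apply ex_RInt_weighted; try lra; apply ex_derive_inv_sub. }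
  assert (Hln : forall x, 0 < x -> ln x <= x - 1).
  { intros x Hx; rewrite <- (ln_exp (x - 1)).
    apply ln_le; [exact Hx |]; pose proof (exp_ineq1_le (x - 1)); lra. }
  assert (Hpos : 0 < / (s * c) * s).
  { apply Rmult_lt_0_compat; [apply Rinv_0_lt_compat; nra | exact Hs]. }
  assert (Hexln : ex_RInt (fun l => ln (/ (s * c) * s * l) * mpDensity l) c 4).
  { apply ex_RInt_weighted; try lra; intros l Hl; auto_derive; nra. }
  assert (Hexk : forall k, ex_RInt (fun l => k * (/ c - / l) * mpDensity l) c 4).
  { intros k; apply (ex_RInt_weighted (fun l => k * (/ c - / l))); try lra.
    intros l Hl; auto_derive; lra. }
  assert (Hlc : forall l, c < l < 4 -> / (s * c) * s * l = l / c /\ 0 < l / c).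
  { intros l Hl; split; [field; lra | apply Rdiv_lt_0_compat; lra]. }
  rewrite <- (Hscal c), <- (Hscal 4).
  split; apply RInt_le; auto; try lra; intros l Hl;
    destruct (Hlc l Hl) as [-> Hpl];
    apply Rmult_le_compat_r; try apply mpDensity_ge0.
  - replace (l / c) with (/ (c / l)) in * by (field; lra).
    rewrite ln_Rinv by (apply Rdiv_lt_0_compat; lra).
    specialize (Hln (c / l) ltac:(apply Rdiv_lt_0_compat; lra)).
    replace (c * (/ c - / l)) with (1 - c / l) by (field; lra).
    lra.
  (* This middle term equals [l / c - 1]; then [l <= 4] gives the factor 4. *)
  - apply Rle_trans with (l * (/ c - / l)).
    + replace (l * (/ c - / l)) with (l / c - 1) by (field; lra); auto.
    + pose proof (inv_sub_pos c l ltac:(lra)); nra.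
Qed.

Lemma capacity_slope :
  filterlim (fun s => capacity s / s) (at_right 0) (locally 4).
Proof.
  apply filterlim_locally; intros eps.
  (* The maximum with 1 keeps [c0] positive for large [eps], and the half makes [4 - eps < c0]
     strict. Every [s] below [snrOfCutoff c0] then has its cutoff between [c0] and 4. *)
  pose (c0 := Rmax 1 (4 - eps / 2)).
  assert (Hc0 : 0 < c0 < 4 /\ 4 - eps < c0).
  { pose proof (cond_pos eps); unfold c0.
    pose proof (Rmax_l 1 (4 - eps / 2)); pose proof (Rmax_r 1 (4 - eps / 2)).
    repeat split; try lra; apply Rmax_lub_lt; lra. }
  pose proof (snrOfCutoff_pos c0 (proj1 Hc0)) as Hdelta.
  exists (mkposreal _ Hdelta); intros s Hs Hpos.
  apply Rabs_lt_between in Hs; simpl in Hs;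
    unfold minus, plus, opp in Hs; simpl in Hs.
  destruct (snrOfCutoff_surj c0 s) as [c [Hc Heq]]; [tauto | lra |].
  pose proof (capacity_bounds c ltac:(lra)) as [H1 H2]; rewrite Heq in H1, H2.
  apply Rabs_lt_between; unfold minus, plus, opp; simpl.
  assert (c <= capacity s / s) by (apply Rle_div_r; lra).
  assert (capacity s / s <= 4) by (apply Rle_div_l; lra).
  pose proof (cond_pos eps); lra.
Qed.

Theorem mainTheorem3 :
  bigO_right0
    (fun d => snrAngle (PI / 2 - d) - 2 * d ^ 5 / (15 * PI))
    (fun d => d ^ 7) /\
  bigO_right0
    (fun d => capacityAngle (PI / 2 - d) - 8 * d ^ 5 / (15 * PI))
    (fun d => d ^ 7) /\
  exists b : R,
    b = 4 /\
    is_lub (fun l => mpDensity l <> 0) b /\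
    filterlim (fun snr => capacity snr / snr) (at_right 0) (locally b).
Proof.
  split; [| split].
  - apply (bigO_right0_of_bound _ _ 1 (1 / 2)); [lra |].
    intros d Hd; rewrite Rmult_1_l, (Rabs_pos_eq (d ^ 7)) by (apply pow_le; lra).
    apply snrAngle_expansion, Hd.
  - apply (bigO_right0_of_bound _ _ 1 (1 / 2)); [lra |].
    intros d Hd; rewrite Rmult_1_l, (Rabs_pos_eq (d ^ 7)) by (apply pow_le; lra).
    apply capacityAngle_expansion, Hd.
  - exists 4; split; [reflexivity |].
    split; [exact mpDensity_is_lub | exact capacity_slope].
Qed.
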